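(* Let $b\ge1$. For general $b\times b$ matrices $B_1,B_2$ over $k$, define the representations $N_1$ (of dimension $(2b,2b)$) and $N_2$ (of dimension $(4b,2b)$) of the $3$-arrow Kronecker quiver $K_3$ by $$N_1(a_1)=\begin{pmatrix}0&-B_1\\0&0\end{pmatrix},\quad N_1(a_2)=\begin{pmatrix}B_1&0\\0&B_1\end{pmatrix},\quad N_1(a_3)=\begin{pmatrix}0&0\\-B_1&0\end{pmatrix},$$ $$N_2(a_1)=\begin{pmatrix}3B_2&0\\0&0\\0&B_2\\0&0\end{pmatrix},\quad N_2(a_2)=\begin{pmatrix}0&0\\0&0\\2B_2&0\\0&2B_2\end{pmatrix},\quad N_2(a_3)=\begin{pmatrix}0&0\\0&3B_2\\0&0\\ B_2&0\end{pmatrix}.$$ Then, for every $a\ge1$, $c_{N_1}$ is a semi-invariant function in $k[U^*\otimes V\otimes S^2(W)^*]$ for $\dim(U,V,W)=(a,2a,2)$, and $c_{N_2}$ is a semi-invariant function in $k[U^*\otimes V\otimes S^2(W)^*]$ for $\dim(U,V,W)=(a,a,2)$.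
   Context: $k$ is a field of characteristic $0$. $K_3$ is the quiver with vertices $1,2$ and three arrows $a_1,a_2,a_3$ from $1$ to $2$. Vectors are row vectors, so a representation $M$ of $K_3$ of dimension $\alpha=(\alpha_1,\alpha_2)$ is a triple of $\alpha_1\times\alpha_2$ matrices $M(a_i)$, acting by right multiplication on row vectors. The span of the arrows is identified with the $\mathrm{GL}(W)$-module $S^2(W)$, where $W=k^2$ has basis $w_1,w_2$, by $a_1=w_1^2$, $a_2=2w_1w_2$, $a_3=w_2^2$. Then $\mathrm{Rep}_\alpha(K_3)$ is identified with $U^*\otimes V\otimes S^2(W)^*$, $\dim U=\alpha_1$, $\dim V=\alpha_2$. $\mathrm{GL}_\alpha=\mathrm{GL}(U)\times\mathrm{GL}(V)$ acts by base change and $G=\mathrm{GL}(W)=\mathrm{GL}_2$ acts by $(gM)(x)=M(g^{-1}x)$ for $x\in S^2(W)$ ($M$ extended linearly to the span of arrows). ''Semi-invariant'' means semi-invariant for $\mathrm{GL}_\alpha\times G$: $g\cdot f=\chi(g)f$ for some character $\chi$. Euler form: $\langle\alpha,\beta\rangle=\alpha_1\beta_1+\alpha_2\beta_2-3\alpha_1\beta_2$. For $M,N$ of dimension $\alpha,\beta$ with $\langle\alpha,\beta\rangle=0$, take an injective resolution $0\to N\to I_0\to I_1\to0$ and set $c_N(M)=c(M,N)=\det\big(\mathrm{Hom}(M,I_0)\to\mathrm{Hom}(M,I_1)\big)$, well defined up to a nonzero constant; $c_N$ is viewed as a function on $\mathrm{Rep}_\alpha(K_3)$. ''General'' means: in a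 nonempty Zariski open subset. *)

(* Defs.v *)
From HB Require Import structures.
From mathcomp Require Import all_boot all_order all_algebra.
From mathcomp Require Import mpoly.

Set Implicit Arguments.
Unset Strict Implicit.
Unset Printing Implicit Defensive.

Import GRing.Theory.
Local Open Scope ring_scope.

Section Generic.
Variable k : fieldType.

(* Complement of the common zero locus of an arbitrary family of polynomials. *)
Definition zariski_open n (O : 'rV[k]_n -> Prop) : Prop :=
  exists F : {mpoly k[n]} -> Prop,
    forall v, O v <-> exists p, F p /\ p.@[fun i => v 0 i] != 0.

Definition for_general n (P : 'rV[k]_n -> Prop) : Prop :=
  exists O : 'rV[k]_n -> Prop,
    [/\ zariski_open O, exists v, O v & forall v, O v -> P v].

Definition for_general_pair b (P : 'M[k]_b -> 'M[k]_b -> Prop) : Prop :=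
  for_general (fun v : 'rV[k]_(b * b + b * b) =>
    P (vec_mx (lsubmx v)) (vec_mx (rsubmx v))).

End Generic.

Section Kronecker.
Variable k : fieldType.

(* Representations of K_3 of dimension (m1, m2): M i is the matrix of the
   arrow a_(i+1), acting on row vectors by right multiplication. *)
Definition rep (m1 m2 : nat) := {ffun 'I_3 -> 'M[k]_(m1, m2)}.

Definition rep3 m1 m2 (A1 A2 A3 : 'M[k]_(m1, m2)) : rep m1 m2 :=
  [ffun i : 'I_3 => [:: A1; A2; A3]`_i].

Definition rep_coords m1 m2 (M : rep m1 m2) : 'rV[k]_(3 * (m1 * m2)) :=
  mxvec (\matrix_(i < 3) mxvec (M i)).

Definition regular_on_rep m1 m2 (f : rep m1 m2 -> k) : Prop :=
  exists p : {mpoly k[3 * (m1 * m2)]},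
    forall M, f M = p.@[fun i => rep_coords M 0 i].

Definition euler_form (m n : nat * nat) : int :=
  (m.1 * n.1)%:Z + (m.2 * n.2)%:Z - (3 * (m.1 * n.2))%:Z.

Definition pair_mx (m1 m2 n1 n2 : nat) : Type :=
  ('M[k]_(m1, n1) * 'M[k]_(m2, n2))%type.

Definition is_hom m1 m2 n1 n2 (M : rep m1 m2) (N : rep n1 n2)
    (phi : pair_mx m1 m2 n1 n2) : Prop :=
  forall i, M i *m phi.2 = phi.1 *m N i.

(* Diagrammatic order: first phi, then psi (maps act on row vectors). *)
Definition hom_comp m1 m2 n1 n2 p1 p2
    (phi : pair_mx m1 m2 n1 n2) (psi : pair_mx n1 n2 p1 p2) :
    pair_mx m1 m2 p1 p2 :=
  (phi.1 *m psi.1, phi.2 *m psi.2).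

Definition hom_mono m1 m2 n1 n2 (phi : pair_mx m1 m2 n1 n2) : Prop :=
  row_free phi.1 /\ row_free phi.2.

Definition hom_epi m1 m2 n1 n2 (phi : pair_mx m1 m2 n1 n2) : Prop :=
  row_full phi.1 /\ row_full phi.2.

Definition hom_exact m1 m2 n1 n2 p1 p2
    (phi : pair_mx m1 m2 n1 n2) (psi : pair_mx n1 n2 p1 p2) : Prop :=
  (phi.1 == kermx psi.1)%MS /\ (phi.2 == kermx psi.2)%MS.

Definition injective_rep d1 d2 (I : rep d1 d2) : Prop :=
  forall m1 m2 n1 n2 (M : rep m1 m2) (N : rep n1 n2)
    (j : pair_mx m1 m2 n1 n2) (phi : pair_mx m1 m2 d1 d2),
    is_hom M N j -> hom_mono j -> is_hom M I phi ->
    exists psi, is_hom N I psi /\ hom_comp j psi = phi.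

Record injective_resolution n1 n2 (N : rep n1 n2) := InjectiveResolution {
  ir_p1 : nat;
  ir_p2 : nat;
  ir_q1 : nat;
  ir_q2 : nat;
  ir_I0 : rep ir_p1 ir_p2;
  ir_I1 : rep ir_q1 ir_q2;
  ir_iota : pair_mx n1 n2 ir_p1 ir_p2;
  ir_pi : pair_mx ir_p1 ir_p2 ir_q1 ir_q2;
  ir_inj0 : injective_rep ir_I0;
  ir_inj1 : injective_rep ir_I1;
  ir_iota_hom : is_hom N ir_I0 ir_iota;
  ir_pi_hom : is_hom ir_I0 ir_I1 ir_pi;
  ir_mono : hom_mono ir_iota;
  ir_exact : hom_exact ir_iota ir_pi;
  ir_epi : hom_epi ir_pi
}.

(* A determinant of Hom(M, I0) -> Hom(M, I1) requires bases of both spaces, and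
   for it to be a function of M up to a single constant these bases have to be
   chosen uniformly in M. For an injective I there are isomorphisms
     Hom(M, I) ~ Hom(M_1, k^x1) (+) Hom(M_2, k^x2),
   natural in M (x1, x2 being the multiplicities in I of the two indecomposable
   injectives); by Yoneda each of them is phi |-> (phi_1 t1, phi_2 t2) for some
   linear maps t1 : I_1 -> k^x1 and t2 : I_2 -> k^x2. *)
Record hom_trivialization d1 d2 (I : rep d1 d2) := HomTrivialization {
  ht_x1 : nat;
  ht_x2 : nat;
  ht_t : pair_mx d1 d2 ht_x1 ht_x2;
  ht_bij : forall m1 m2 (M : rep m1 m2) (P : pair_mx m1 m2 ht_x1 ht_x2),
    exists! phi : pair_mx m1 m2 d1 d2, is_hom M I phi /\ hom_comp phi ht_t = P
}.

Definition hom_dim d1 d2 (I : rep d1 d2) (T : hom_trivialization I)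
    (m1 m2 : nat) : nat :=
  (m1 * ht_x1 T + m2 * ht_x2 T)%N.

Definition hom_coords d1 d2 (I : rep d1 d2) (T : hom_trivialization I)
    m1 m2 (phi : pair_mx m1 m2 d1 d2) : 'rV[k]_(hom_dim T m1 m2) :=
  let P := hom_comp phi (ht_t T) in row_mx (mxvec P.1) (mxvec P.2).

(* c is (one of the nonzero multiples of) the function c_N on the
   representations of dimension (m1, m2): D is the matrix of
   Hom(M, I0) -> Hom(M, I1), phi |-> phi ; pi. The cast identifies
   dim Hom(M, I1) with dim Hom(M, I0); they agree as the Euler form vanishes. *)
Definition is_schofield n1 n2 (N : rep n1 n2) m1 m2 (c : rep m1 m2 -> k)
    : Prop :=
  euler_form (m1, m2) (n1, n2) = 0 /\
  exists (R : injective_resolution N)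
         (T0 : hom_trivialization (ir_I0 R))
         (T1 : hom_trivialization (ir_I1 R))
         (e : hom_dim T1 m1 m2 = hom_dim T0 m1 m2),
  forall M : rep m1 m2,
  exists D : 'M[k]_(hom_dim T0 m1 m2),
    (forall phi, is_hom M (ir_I0 R) phi ->
       hom_coords T0 phi *m D =
       castmx (erefl, e) (hom_coords T1 (hom_comp phi (ir_pi R)))) /\
    c M = \det D.

(* S^2(W), W = k^2 (column vectors), realized as the symmetric 2 x 2 matrices
   (symmetric tensors, k being of characteristic 0) with product
   u v = (u (x) v + v (x) u) / 2. *)

Definition sym_mul (u v : 'cV[k]_2) : 'M[k]_2 :=
  2%:R^-1 *: (u *m v^T + v *m u^T).

Definition w1 : 'cV[k]_2 := delta_mx 0 0.
Definition w2 : 'cV[k]_2 := delta_mx 1 0.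

Definition arrow (i : 'I_3) : 'M[k]_2 :=
  [:: sym_mul w1 w1; 2%:R *: sym_mul w1 w2; sym_mul w2 w2]`_i.

Definition sym_act (h x : 'M[k]_2) : 'M[k]_2 := h *m x *m h^T.

Lemma sym_act_mul (h : 'M[k]_2) (u v : 'cV[k]_2) :
  sym_act h (sym_mul u v) = sym_mul (h *m u) (h *m v).
Proof.
rewrite /sym_act /sym_mul -scalemxAr -scalemxAl mulmxDr mulmxDl !trmx_mul.
by rewrite !mulmxA.
Qed.

Definition arrow_coord (x : 'M[k]_2) (i : 'I_3) : k :=
  [:: x 0 0; x 0 1; x 1 1]`_i.

Lemma arrow_coordP (x : 'M[k]_2) : [pchar k] =i pred0 -> x^T = x ->
  x = \sum_i arrow_coord x i *: arrow i.
Proof.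
move=> /pcharf0P k0 xT; have n2 : (2%:R : k) != 0 by rewrite k0.
have x10 : x 1 0 = x 0 1 by rewrite -{1}xT mxE.
apply/matrixP => i j; rewrite summxE !big_ord_recl big_ord0 /arrow_coord /arrow /=.
rewrite /sym_mul /w1 /w2 !trmx_delta !mul_delta_mx !mxE.
case: i => [[|[|//]] hi]; case: j => [[|[|//]] hj] /=;
  rewrite ?(mulr0, mul0r, addr0, add0r, mulr1) -?mulr2n ?mulVf ?divff //
          ?mulr0 ?addr0 ?add0r ?mulr1.
- by congr (x _ _); apply/val_inj.
- by congr (x _ _); apply/val_inj.
- by rewrite -x10; congr (x _ _); apply/val_inj.
- by congr (x _ _); apply/val_inj.
Qed.

Definition rep_ext m1 m2 (M : rep m1 m2) (x : 'M[k]_2) : 'M[k]_(m1, m2) :=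
  \sum_i arrow_coord x i *: M i.

Definition triple_mx (m1 m2 : nat) : Type :=
  ('M[k]_m1 * 'M[k]_m2 * 'M[k]_2)%type.

Section Group.
Variables m1 m2 : nat.
Implicit Types g : triple_mx m1 m2.

Definition in_GL g : bool :=
  [&& g.1.1 \in unitmx, g.1.2 \in unitmx & g.2 \in unitmx].

Definition GL_mul g g' : triple_mx m1 m2 :=
  (g.1.1 *m g'.1.1, g.1.2 *m g'.1.2, g.2 *m g'.2).

Definition GL_inv g : triple_mx m1 m2 :=
  (invmx g.1.1, invmx g.1.2, invmx g.2).

Definition GL_coords g : 'rV[k]_(m1 * m1 + m2 * m2 + 2 * 2) :=
  row_mx (row_mx (mxvec g.1.1) (mxvec g.1.2)) (mxvec g.2).

(* Characters of the algebraic group: homomorphisms to the multiplicative group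
   which are regular, i.e. polynomial in the entries and the inverses of the
   determinants. *)
Definition is_character (chi : triple_mx m1 m2 -> k) : Prop :=
  [/\ forall g, in_GL g -> chi g != 0,
      forall g g', in_GL g -> in_GL g' -> chi (GL_mul g g') = chi g * chi g'
    & exists (p : {mpoly k[m1 * m1 + m2 * m2 + 2 * 2]}) (n : nat),
        forall g, in_GL g ->
          chi g = p.@[fun i => GL_coords g 0 i]
                  / (\det g.1.1 * \det g.1.2 * \det g.2) ^+ n].

(* g1 in GL(U) acts on U (row vectors) by u |-> u g1^-1, and likewise for V, so
   that base change is M(x) |-> g1 M(x) g2^-1; h in GL(W) acts by precomposition
   with h^-1 on S^2(W). *)
Definition rep_act g (M : rep m1 m2) : rep m1 m2 :=
  [ffun i => g.1.1 *m rep_ext M (sym_act (invmx g.2) (arrow i))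
             *m invmx g.1.2].

Definition fun_act g (f : rep m1 m2 -> k) : rep m1 m2 -> k :=
  fun M => f (rep_act (GL_inv g) M).

Definition semi_invariant (f : rep m1 m2 -> k) : Prop :=
  regular_on_rep f /\
  exists chi, is_character chi /\
    forall g, in_GL g -> forall M, fun_act g f M = chi g * f M.

End Group.

Definition N1 b (B : 'M[k]_b) : rep (b + b) (b + b) :=
  rep3 (block_mx 0 (- B) 0 0)
       (block_mx B 0 0 B)
       (block_mx 0 0 (- B) 0).

Definition N2 b (B : 'M[k]_b) : rep (b + b + (b + b)) (b + b) :=
  rep3 (col_mx (block_mx (3%:R *: B) 0 0 0)
               (block_mx 0 B 0 0))
       (col_mx 0
               (block_mx (2%:R *: B) 0 0 (2%:R *: B)))
       (col_mx (block_mx 0 0 0 (3%:R *: B))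
               (block_mx 0 0 B 0)).

End Kronecker.

(* Main.v *)
(* For any injective resolution N -> I0 -> I1 with any trivializations, the
   determinant of Hom(M, I0) -> Hom(M, I1) is a constant multiple of the
   determinant of
     Hom(M1, N1) (+) Hom(M2, N2) -> Hom(M1, N2)^3,
     (x, y) |-> (M(a_i) y - x N(a_i))_i,
   which is polynomial in M.  Replacing M by a translate under
   GL(U) x GL(V) multiplies it by a scalar independent of M, and so does the
   action of GL(W), because N1 and N2 are obtained by tensoring B with the
   GL(W)-equivariant contractions S^2(W) (x) W^* -> W and
   S^2(W) (x) S^3(W^* ) -> W^*, up to a choice of bases. *)
From HB Require Import structures.
Require Import Defs.
From mathcomp Require Import all_boot all_order all_algebra.
From mathcomp Require Import mpoly ring.
From Stdlib Require Import Classical_Prop.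

Set Implicit Arguments.
Unset Strict Implicit.
Unset Printing Implicit Defensive.

Import GRing.Theory.
Local Open Scope ring_scope.

(** * Determinants of linear maps in coordinates *)

(** The resolution and the trivializations are arbitrary, and of a trivialization only the unique
    lifting property is known, while the space Hom(M, I) itself moves with M. Determinants on it
    therefore cannot be compared directly for different M. The remedy is to drop the homomorphism
    condition: determinants are taken between spaces of matrices that depend on dimensions only, and
    Hom(M, I) appears as a fibre of an isomorphism whose determinant does not depend on M. For the
    group action, a scalar is first obtained separately for each group element, as a mere existence
    statement; that these scalars form a regular character is read off afterwards from the values of
    the function itself. The existence half of the claim is settled by the canonical injective
    resolution. *)

Section CoordinateDeterminant.
Variable k : fieldType.

(** Explicit coordinates rather than an abstract basis: the determinants must be taken in exactly
    the [mxvec] and [row_mx] coordinates that [hom_coords] prescribes. *)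
Record coords (V : lmodType k) (n : nat) := Coords {
  enc : V -> 'rV[k]_n;
  dec : 'rV[k]_n -> V;
  enc_linear : linear enc;
  encK : cancel enc dec;
  decK : cancel dec enc
}.

Definition linear_pack (U V : lmodType k) (f : U -> V) (lf : linear f) :
  {linear U -> V} := HB.pack f (GRing.isLinear.Build k U V *:%R f lf).

Lemma dec_linear (V : lmodType k) n (c : coords V n) : linear (dec c).
Proof.
by move=> a u v; apply: (can_inj (encK c)); rewrite enc_linear !decK.
Qed.

Lemma linear_fun0 (U V : lmodType k) (f : U -> V) : linear f -> f 0 = 0.
Proof. by move=> lf; exact: (linear0 (linear_pack lf)). Qed.

Lemma linear_comp (U V W : lmodType k) (f : U -> V) (g : V -> W) :
  linear f -> linear g -> linear (g \o f).
Proof. by move=> lf lg a u v /=; rewrite lf lg. Qed.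

Section Maps.
Variables (U V : lmodType k) (p q : nat) (cU : coords U p) (cV : coords V q).

Definition coord_mx (f : U -> V) : 'M[k]_(p, q) :=
  \matrix_i enc cV (f (dec cU (delta_mx 0 i))).

(* The factor [pid_mx q] is the identity when [p = q]; it makes the matrix
   square without a cast. *)
Definition coord_det (f : U -> V) : k :=
  \det (coord_mx f *m (pid_mx q : 'M_(q, p))).

Lemma coord_mxE (f : U -> V) : linear f ->
  forall u, enc cV (f u) = enc cU u *m coord_mx f.
Proof.
move=> lf u.
have lg : linear (enc cV \o f \o dec cU).
  by apply: linear_comp; [exact: dec_linear | apply: linear_comp; [|exact: enc_linear]].
rewrite -{1}(encK cU u).
have -> : coord_mx f = lin1_mx (linear_pack lg).
  by apply/row_matrixP => i; rewrite rowK rowE (mul_rV_lin1 (linear_pack lg)).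
by rewrite (mul_rV_lin1 (linear_pack lg)).
Qed.

Lemma eq_coord_mx (f g : U -> V) : f =1 g -> coord_mx f = coord_mx g.
Proof. by move=> fg; apply/row_matrixP => i; rewrite !rowK fg. Qed.

Lemma eq_coord_det (f g : U -> V) : f =1 g -> coord_det f = coord_det g.
Proof. by move=> /eq_coord_mx fg; rewrite /coord_det fg. Qed.

End Maps.

Lemma mulmx_eqr m n (A B : 'M[k]_(m, n)) : (forall u : 'rV_m, u *m A = u *m B) -> A = B.
Proof. by move=> AB; apply/row_matrixP => i; rewrite !rowE AB. Qed.

Lemma coord_mx_comp (U V W : lmodType k) p q r
    (cU : coords U p) (cV : coords V q) (cW : coords W r) (f : U -> V) (g : V -> W) :
  linear f -> linear g ->
  coord_mx cU cW (g \o f) = coord_mx cU cV f *m coord_mx cV cW g.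
Proof.
move=> lf lg; apply: mulmx_eqr => u.
rewrite -(decK cU u) -coord_mxE /=; last exact: linear_comp.
by rewrite mulmxA -coord_mxE // -coord_mxE.
Qed.

Lemma coord_det_comp (U V W : lmodType k) p q r
    (cU : coords U p) (cV : coords V q) (cW : coords W r) (f : U -> V) (g : V -> W) :
  linear f -> linear g -> p = q ->
  coord_det cU cW (g \o f) = coord_det cU cV f * coord_det cV cW g.
Proof.
move=> lf lg epq; rewrite /coord_det (coord_mx_comp cU cV) //; subst q.
by rewrite pid_mx_1 mulmx1 -mulmxA det_mulmx.
Qed.

Lemma coord_mx_id (U : lmodType k) p (cU : coords U p) (f : U -> U) :
  f =1 id -> coord_mx cU cU f = 1%:M.
Proof.
by move=> fid; apply/row_matrixP => i; rewrite rowK fid decK rowE mulmx1.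
Qed.

Lemma coord_det_id (U : lmodType k) p (cU : coords U p) (f : U -> U) :
  f =1 id -> coord_det cU cU f = 1.
Proof. by move=> /coord_mx_id fid; rewrite /coord_det fid pid_mx_1 mulmx1 det1. Qed.

Lemma coord_dim_eq (U V : lmodType k) p q (cU : coords U p) (cV : coords V q)
    (f : U -> V) (g : V -> U) :
  linear f -> linear g -> cancel f g -> cancel g f -> p = q.
Proof.
move=> lf lg fK gK.
have: coord_mx cU cV f *m coord_mx cV cU g = 1%:M.
  by rewrite -coord_mx_comp // coord_mx_id.
have: coord_mx cV cU g *m coord_mx cU cV f = 1%:M.
  by rewrite -coord_mx_comp // coord_mx_id.
move: (coord_mx _ _ _) (coord_mx _ _ _) => B A BA AB.
have le_dim m n (C : 'M[k]_(m, n)) D : C *m D = 1%:M -> (m <= n)%N.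
  by move=> CD; rewrite -(mxrank1 k m) -CD (leq_trans (mxrankM_maxl _ _)) ?rank_leq_col.
by apply/eqP; rewrite eqn_leq (le_dim _ _ _ _ AB) (le_dim _ _ _ _ BA).
Qed.

Lemma coord_det_neq0 (U V : lmodType k) p q (cU : coords U p) (cV : coords V q)
    (f : U -> V) (g : V -> U) :
  linear f -> linear g -> cancel f g -> cancel g f -> coord_det cU cV f != 0.
Proof.
move=> lf lg fK gK; have epq := coord_dim_eq cU cV lf lg fK gK.
have /eqP := coord_det_comp cU cV cU lf lg epq.
rewrite coord_det_id //; apply: contraTneq => ->.
by rewrite mul0r oner_eq0.
Qed.

(** Trivializations yield bijectivity only as existence and uniqueness; the pseudo-inverse of the
    coordinate matrix turns this into an inverse map without any choice. *)
Lemma linear_bij_inverse (U V : lmodType k) p q (cU : coords U p) (cV : coords V q)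
    (f : U -> V) :
  linear f -> (forall u, f u = 0 -> u = 0) -> (forall v, exists u, f u = v) ->
  exists2 g : V -> U, linear g & cancel f g /\ cancel g f.
Proof.
move=> lf finj fsurj; pose A := coord_mx cU cV f.
have freeA : row_free A.
  apply/row_freeP; exists (pinvmx A); apply: mulmxVp.
  rewrite -kermx_eq0; apply/eqP/row_matrixP => i; rewrite row0.
  have uA : row i (kermx A) *m A = 0 by rewrite -row_mul mulmx_ker row0.
  rewrite -(decK cU (row i (kermx A))) (finj (dec cU (row i (kermx A)))).
    exact/linear_fun0/enc_linear.
  apply: (can_inj (encK cV)); rewrite (coord_mxE cU cV lf) decK uA.
  by rewrite linear_fun0 //; exact: enc_linear.
pose g v := dec cU (enc cV v *m pinvmx A).
have fK : cancel f g.
  by move=> u; rewrite /g (coord_mxE cU cV lf) -mulmxA mulmxVp ?mulmx1 ?encK.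
exists g; last by split=> // v; have [u <-] := fsurj v; rewrite fK.
by move=> a u v; rewrite /g enc_linear mulmxDl -scalemxAl dec_linear.
Qed.

Definition coords_mx m n : coords 'M[k]_(m, n) (m * n) :=
  @Coords _ _ mxvec vec_mx (@linearP _ _ _ _ mxvec) mxvecK vec_mxK.

Section Pair.
Variables (U V : lmodType k) (p q : nat) (cU : coords U p) (cV : coords V q).
Let e (x : U * V) := row_mx (enc cU x.1) (enc cV x.2).
Let d (v : 'rV[k]_(p + q)) := (dec cU (lsubmx v), dec cV (rsubmx v)).

Fact coords_pair_linear : linear e.
Proof.
by move=> a u v; rewrite /e /= !enc_linear scale_row_mx add_row_mx.
Qed.

Fact coords_pairK : cancel e d.
Proof. by case=> u v; rewrite /e /d /= row_mxKl row_mxKr !encK. Qed.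

Fact coords_pairVK : cancel d e.
Proof. by move=> v; rewrite /e /d /= !decK hsubmxK. Qed.

Definition coords_pair : coords (U * V)%type (p + q) :=
  Coords coords_pair_linear coords_pairK coords_pairVK.

End Pair.

Section Triangular.
Variables (U V U' V' : lmodType k) (p q p' q' : nat).
Variables (cU : coords U p) (cV : coords V q) (cU' : coords U' p') (cV' : coords V' q').
Variables (a : U -> U') (c : V -> V').
Hypotheses (epp' : p = p') (eqq' : q = q').

Let det_lblock_pid (A : 'M[k]_(p, p')) B (D : 'M[k]_(q, q')) :
  \det (block_mx A 0 B D *m pid_mx (p' + q')) = \det (A *m pid_mx p') * \det (D *m pid_mx q').
Proof.
case: _ / epp' A B => A; case: _ / eqq' D => D B.
by rewrite !pid_mx_1 !mulmx1 det_lblock.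
Qed.

Let det_ublock_pid (A : 'M[k]_(p, p')) B (D : 'M[k]_(q, q')) :
  \det (block_mx A B 0 D *m pid_mx (p' + q')) = \det (A *m pid_mx p') * \det (D *m pid_mx q').
Proof.
case: _ / epp' A B => A; case: _ / eqq' D => D B.
by rewrite !pid_mx_1 !mulmx1 det_ublock.
Qed.

Let coord_mx_block (f : U * V -> U' * V') :
  coord_mx (coords_pair cU cV) (coords_pair cU' cV') f =
  block_mx (coord_mx cU cU' (fun x => (f (x, 0)).1)) (coord_mx cU cV' (fun x => (f (x, 0)).2))
           (coord_mx cV cU' (fun y => (f (0, y)).1)) (coord_mx cV cV' (fun y => (f (0, y)).2)).
Proof.
have d0 := linear_fun0 (dec_linear _).
apply/row_matrixP => i; rewrite -[block_mx _ _ _ _]/(col_mx (row_mx _ _) (row_mx _ _)) rowK.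
case: (split_ordP i) => j ->; rewrite /= ?delta_mx_lshift ?delta_mx_rshift.
  by rewrite rowKu row_row_mx !rowK row_mxKl row_mxKr d0.
by rewrite rowKd row_row_mx !rowK row_mxKl row_mxKr d0.
Qed.

(** Matrices act on row vectors, so a map preserving the first summand has its upper right block
    equal to zero. *)
Lemma coord_det_lower (f : U * V -> U' * V') :
  (forall x, f (x, 0) = (a x, 0)) -> (forall y, (f (0, y)).2 = c y) ->
  coord_det (coords_pair cU cV) (coords_pair cU' cV') f =
  coord_det cU cU' a * coord_det cV cV' c.
Proof.
move=> fa fc; rewrite /coord_det coord_mx_block.
rewrite [X in block_mx _ X _ _](_ : _ = 0) ?det_lblock_pid.
  by rewrite (@eq_coord_mx _ _ _ _ cU cU' _ a) ?(@eq_coord_mx _ _ _ _ cV cV' _ c) // => x;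
     rewrite ?fa ?fc.
apply/row_matrixP => i; rewrite !rowK fa row0; exact/linear_fun0/enc_linear.
Qed.

Lemma coord_det_upper (f : U * V -> U' * V') :
  (forall x, (f (x, 0)).1 = a x) -> (forall y, f (0, y) = (0, c y)) ->
  coord_det (coords_pair cU cV) (coords_pair cU' cV') f =
  coord_det cU cU' a * coord_det cV cV' c.
Proof.
move=> fa fc; rewrite /coord_det coord_mx_block.
rewrite [X in block_mx _ _ X _](_ : _ = 0) ?det_ublock_pid.
  by rewrite (@eq_coord_mx _ _ _ _ cU cU' _ a) ?(@eq_coord_mx _ _ _ _ cV cV' _ c) // => x;
     rewrite ?fa ?fc.
apply/row_matrixP => i; rewrite !rowK fc row0; exact/linear_fun0/enc_linear.
Qed.

End Triangular.

Definition rep_decode m1 m2 (v : 'rV[k]_(3 * (m1 * m2))) : rep k m1 m2 :=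
  [ffun i => vec_mx (row i (vec_mx v))].

Lemma rep_coordsK m1 m2 : cancel (@rep_coords k m1 m2) (@rep_decode m1 m2).
Proof. by move=> M; apply/ffunP => i; rewrite ffunE mxvecK rowK mxvecK. Qed.

Lemma rep_decodeK m1 m2 : cancel (@rep_decode m1 m2) (@rep_coords k m1 m2).
Proof.
move=> v; rewrite /rep_coords -[RHS]vec_mxK; congr mxvec.
by apply/row_matrixP => i; rewrite rowK ffunE vec_mxK.
Qed.

Lemma rep_coords_linear m1 m2 : linear (@rep_coords k m1 m2 : {ffun 'I_3 -> 'M[k]_(m1, m2)} -> _).
Proof.
move=> a M N; rewrite /rep_coords -linearP; congr mxvec; apply/row_matrixP => i.
by rewrite linearP /= !rowK !ffunE linearP.
Qed.

Definition coords_rep m1 m2 : coords {ffun 'I_3 -> 'M[k]_(m1, m2)} (3 * (m1 * m2)) :=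
  Coords (@rep_coords_linear m1 m2) (@rep_coordsK m1 m2) (@rep_decodeK m1 m2).

Definition coords_homs m1 m2 n1 n2 :
    coords ('M[k]_(m1, n1) * 'M[k]_(m2, n2))%type (m1 * n1 + m2 * n2) :=
  coords_pair (coords_mx m1 n1) (coords_mx m2 n2).

End CoordinateDeterminant.

(** * Trivializations of injective representations *)

Section Homs.
Variable k : fieldType.

(** The differential of the standard two-term complex of a quiver: its kernel is Hom(M, N) and its
    cokernel is Ext(M, N). *)
Definition hom_diff m1 m2 n1 n2 (N : rep k n1 n2) (M : rep k m1 m2)
    (x : 'M[k]_(m1, n1) * 'M[k]_(m2, n2)) : {ffun 'I_3 -> 'M[k]_(m1, n2)} :=
  [ffun i => M i *m x.2 - x.1 *m N i].

Lemma hom_diff_linear m1 m2 n1 n2 (N : rep k n1 n2) (M : rep k m1 m2) :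
  linear (hom_diff N M).
Proof.
move=> a x y; apply/ffunP => i; rewrite !ffunE /=.
by rewrite mulmxDr mulmxDl -scalemxAl -scalemxAr scalerBr opprD addrACA.
Qed.

Lemma hom_diff_eq0 m1 m2 n1 n2 (N : rep k n1 n2) (M : rep k m1 m2) x :
  hom_diff N M x = 0 <-> is_hom M N x.
Proof.
split=> [/ffunP xN i|xN]; first by have /eqP := xN i; rewrite !ffunE subr_eq0 => /eqP.
by apply/ffunP => i; rewrite !ffunE xN subrr.
Qed.

Lemma hom_comp_linear m1 m2 n1 n2 p1 p2 (psi : pair_mx k n1 n2 p1 p2) :
  linear ((hom_comp (p2 := p2))^~ psi : ('M_(m1, n1) * 'M_(m2, n2)) -> 'M_(m1, p1) * 'M_(m2, p2)).
Proof. by move=> a x y; rewrite /hom_comp /= !mulmxDl -!scalemxAl. Qed.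

(** Three maps to k^n packed into one map to (k^n)^3, with [arrow_proj] as the three projections;
    this serves both for enlarged test representations and for building injectives. *)
Definition rep_flat m n (tau : rep k m n) : 'M[k]_(m, 3 * n) :=
  \matrix_a mxvec (\matrix_(i < 3) row a (tau i)).

Definition arrow_proj n (i : 'I_3) : 'M[k]_(3 * n, n) :=
  \matrix_(r, c) (r == mxvec_index i c)%:R.

Lemma mul_arrow_proj m n (X : 'M[k]_(m, 3 * n)) i a c :
  (X *m arrow_proj n i) a c = X a (mxvec_index i c).
Proof.
rewrite mxE (bigD1 (mxvec_index i c)) //= mxE eqxx mulr1 big1 ?addr0 // => r ne.
by rewrite mxE (negPf ne) mulr0.
Qed.

Lemma rep_flatK m n (tau : rep k m n) i : rep_flat tau *m arrow_proj n i = tau i.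
Proof.
by apply/matrixP => a c; rewrite mul_arrow_proj mxE mxvecE !mxE.
Qed.

Lemma arrow_proj_inj m n (X Y : 'M[k]_(m, 3 * n)) :
  (forall i, X *m arrow_proj n i = Y *m arrow_proj n i) -> X = Y.
Proof.
move=> XY; apply/matrixP => a r; case/mxvec_indexP: r => i c.
by rewrite -!mul_arrow_proj XY.
Qed.

Section Trivialization.
Variables (d1 d2 x1 x2 : nat) (I : rep k d1 d2) (t : pair_mx k d1 d2 x1 x2).
Hypothesis t_bij : forall m1 m2 (M : rep k m1 m2) (P : pair_mx k m1 m2 x1 x2),
  exists! phi : pair_mx k m1 m2 d1 d2, is_hom M I phi /\ hom_comp phi t = P.

(** An isomorphism between spaces independent of [M]; Hom(M, I) is the part lying over 0 in the
    first component, where [theta] restricts to the trivialization. *)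
Definition theta m1 m2 (M : rep k m1 m2) (x : 'M[k]_(m1, d1) * 'M[k]_(m2, d2)) :
    {ffun 'I_3 -> 'M[k]_(m1, d2)} * ('M[k]_(m1, x1) * 'M[k]_(m2, x2)) :=
  (hom_diff I M x, hom_comp x t).

Lemma theta_linear m1 m2 (M : rep k m1 m2) : linear (theta M).
Proof. by move=> a x y; rewrite /theta hom_diff_linear hom_comp_linear. Qed.

Lemma theta0 m1 m2 (M : rep k m1 m2) : theta M 0 = 0.
Proof. exact: linear_fun0 (theta_linear M). Qed.

Lemma theta_ker m1 m2 (M : rep k m1 m2) x : theta M x = 0 -> x = 0.
Proof.
case=> /hom_diff_eq0 xI xt1 xt2; have [phi [_ phi_uniq]] := t_bij M (0, 0).
rewrite -(phi_uniq x); first by apply: phi_uniq; split;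
  [move=> i; rewrite mulmx0 mul0mx | rewrite /hom_comp !mul0mx].
by split=> //; rewrite /hom_comp xt1 xt2.
Qed.

(** On a representation whose first space is zero every pair of matrices is a homomorphism, so the
    uniqueness of lifts becomes injectivity of [t.2]. *)
Lemma triv2_inj m (Y : 'M[k]_(m, d2)) : Y *m t.2 = 0 -> Y = 0.
Proof.
move=> Yt; suff: (0 : 'M[k]_(0, d1), Y) = 0 by case.
apply: (@theta_ker 0 m 0); rewrite /theta /hom_comp Yt /= mul0mx.
by congr (_, _); apply/ffunP => i; rewrite !ffunE !mul0mx subrr.
Qed.

(* Extending [M] by three copies of [k^m1] at the target vertex, one for each
   arrow, turns an arbitrary [tau] into part of a homomorphism to [I]. *)
Lemma theta_surj m1 m2 (M : rep k m1 m2) y : exists x, theta M x = y.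
Proof.
case: y => tau [P1 P2].
pose M' : rep k m1 (m2 + 3 * m1) := [ffun i => row_mx (M i) (arrow_proj m1 i)^T].
pose B : 'M[k]_(3 * m1, d2) := (rep_flat [ffun i => (tau i)^T])^T.
have EB i : (arrow_proj m1 i)^T *m B = tau i.
  by rewrite /B -trmx_mul rep_flatK ffunE trmxK.
have [[f1 f2] [[f_hom]]] := t_bij M' (P1, col_mx P2 (- (B *m t.2))).
rewrite /hom_comp /= -[f2]vsubmxK mul_col_mx => -[f1t /eq_col_mx[f2t f2b]] _.
have {}f2b : dsubmx f2 = - B.
  by apply/eqP; rewrite -addr_eq0; apply/eqP/triv2_inj; rewrite mulmxDl f2b addNr.
exists (f1, usubmx f2); rewrite /theta /hom_comp /= f1t f2t; congr (_, _).
apply/ffunP => i; rewrite ffunE /= -[f1 *m _]f_hom ffunE /= -{2}[f2]vsubmxK mul_row_col.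
by rewrite f2b mulmxN EB opprD addrA subrr sub0r opprK.
Qed.

Definition coords_theta m1 m2 :=
  coords_pair (coords_rep k m1 d2) (coords_homs k m1 m2 x1 x2).

Lemma theta_inverse m1 m2 (M : rep k m1 m2) :
  exists2 g, linear g & cancel (theta M) g /\ cancel g (theta M).
Proof.
apply: (linear_bij_inverse (coords_homs k m1 m2 d1 d2) (coords_theta m1 m2)).
- exact: theta_linear.
- exact: theta_ker.
- exact: theta_surj.
Qed.

(** [theta M] is [theta 0] precomposed with a shear. The correction is a preimage of the maps
    [M i *m x.2] under [theta 0]; its second component is killed by [t.2], hence zero, so [x.1] is
    shifted by a linear function of [x.2] and the shear has determinant 1. *)
Lemma coord_det_theta m1 m2 (M : rep k m1 m2) :
  coord_det (coords_homs k m1 m2 d1 d2) (coords_theta m1 m2) (theta M) =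
  coord_det (coords_homs k m1 m2 d1 d2) (coords_theta m1 m2) (theta (0 : {ffun 'I_3 -> 'M_(m1, m2)})).
Proof.
pose M0 : rep k m1 m2 := (0 : {ffun 'I_3 -> 'M_(m1, m2)}).
have [g lg [gK thetaK]] := theta_inverse M0.
pose z (Y : 'M[k]_(m2, d2)) : {ffun 'I_3 -> 'M[k]_(m1, d2)} * ('M[k]_(m1, x1) * 'M[k]_(m2, x2)) :=
  ([ffun i => M i *m Y], 0).
have lz : linear z.
  move=> a X Y; congr (_, _); last by rewrite /= scaler0 add0r.
  by apply/ffunP => i; rewrite !ffunE /= mulmxDr scalemxAr.
pose u (x : 'M[k]_(m1, d1) * 'M[k]_(m2, d2)) := (x.1 + (g (z x.2)).1, x.2).
have gz2 Y : (g (z Y)).2 = 0.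
  by apply: triv2_inj; have [_ _] := thetaK (z Y).
have lu : linear u.
  by move=> a x y; congr (_, _); rewrite /= lz lg /= scalerDr addrACA.
have thu x : theta M x = theta M0 (u x).
  have -> : u x = x + g (z x.2).
    by rewrite /u [RHS]surjective_pairing /= gz2 addr0.
  have := theta_linear M0 1 x (g (z x.2)); rewrite !scale1r thetaK => ->.
  rewrite /theta /z [RHS]surjective_pairing /= addr0; congr (_, _).
  by apply/ffunP => i; rewrite !ffunE mul0mx sub0r addrC.
rewrite (eq_coord_det _ _ thu) -/(theta M0 \o u).
rewrite (@coord_det_comp _ _ _ _ _ _ _ _ (coords_homs k m1 m2 d1 d2) _ u (theta M0)) //;
  last exact: theta_linear.
rewrite (@coord_det_lower _ _ _ _ _ _ _ _ _ _ _ _ _ id id) ?coord_det_id ?mul1r // => x.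
by rewrite /u /= (linear_fun0 lz) (linear_fun0 lg) addr0.
Qed.

Lemma theta_dim m1 m2 : (m1 * d1 + m2 * d2 = 3 * (m1 * d2) + (m1 * x1 + m2 * x2))%N.
Proof.
have [g lg [gK gVK]] := theta_inverse (0 : {ffun 'I_3 -> 'M_(m1, m2)}).
exact: (@coord_dim_eq _ _ _ _ _ (coords_homs k m1 m2 d1 d2) (coords_theta m1 m2) _ g
          (theta_linear _) lg gK gVK).
Qed.

Lemma coord_det_theta_neq0 m1 m2 (M : rep k m1 m2) :
  coord_det (coords_homs k m1 m2 d1 d2) (coords_theta m1 m2) (theta M) != 0.
Proof.
have [g lg [gK gVK]] := theta_inverse M.
exact: (@coord_det_neq0 _ _ _ _ _ _ _ _ g (theta_linear _) lg gK gVK).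
Qed.

End Trivialization.
End Homs.

(** * Comparison of resolutions *)

Section SchofieldDeterminant.
Variable k : fieldType.

Lemma coord_det_cast (U V : lmodType k) p q (cU : coords U p) (cV : coords V q)
    (f : U -> V) (e : q = p) (D : 'M[k]_p) :
  linear f -> (forall u, enc cU u *m D = castmx (erefl, e) (enc cV (f u))) ->
  coord_det cU cV f = \det D.
Proof.
move=> lf fD; subst q; rewrite /coord_det pid_mx_1 mulmx1; congr (\det _).
by apply: mulmx_eqr => u; rewrite -(decK cU u) -coord_mxE //.
Qed.

Lemma linear_pair (U V W : lmodType k) (f : U -> V) (g : U -> W) :
  linear f -> linear g -> linear (fun x => (f x, g x)).
Proof. by move=> lf lg a x y; rewrite lf lg. Qed.

(** Applied at each vertex separately: the retraction and the section are only linear and need not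
    be homomorphisms of representations. *)
Lemma split_exact n p q (i : 'M[k]_(n, p)) (pi : 'M[k]_(p, q)) :
  row_free i -> (i == kermx pi)%MS -> row_full pi ->
  exists rho s, [/\ i *m rho = 1%:M, s *m pi = 1%:M, i *m pi = 0, s *m rho = 0
                  & rho *m i + pi *m s = 1%:M].
Proof.
move=> ifree iker /row_fullP[s sK].
have ipi : i *m pi = 0 by apply/sub_kermxP; rewrite (eqmxP iker).
have /submxP[rho rhoE] : (1%:M - pi *m s <= i)%MS.
  by rewrite (eqmxP iker); apply/sub_kermxP; rewrite mulmxBl mul1mx -mulmxA sK mulmx1 subrr.
exists rho, s; split => //.
- apply: (row_free_inj ifree).
  by rewrite -mulmxA -rhoE mulmxBr mulmx1 mulmxA ipi mul0mx subr0 mul1mx.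
- apply: (row_free_inj ifree).
  by rewrite -mulmxA -rhoE mulmxBr mulmx1 mulmxA sK mul1mx subrr mul0mx.
- by rewrite -rhoE subrK.
Qed.

Definition rep_mulr m n p (A : 'M[k]_(n, p)) (tau : {ffun 'I_3 -> 'M[k]_(m, n)}) :
  {ffun 'I_3 -> 'M[k]_(m, p)} := [ffun i => tau i *m A].

Lemma rep_mulr_linear m n p (A : 'M[k]_(n, p)) : linear (@rep_mulr m n p A).
Proof. by move=> a x y; apply/ffunP => i; rewrite !ffunE mulmxDl -scalemxAl. Qed.

Lemma hom_diff_compr m1 m2 n1 n2 p1 p2 (N : rep k n1 n2) (Q : rep k p1 p2)
    (f : pair_mx k n1 n2 p1 p2) (M : rep k m1 m2) x :
  is_hom N Q f -> hom_diff Q M (hom_comp x f) = rep_mulr f.2 (hom_diff N M x).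
Proof.
move=> f_hom; apply/ffunP => i; rewrite !ffunE /= mulmxBl -!mulmxA.
by rewrite f_hom.
Qed.

Definition std_det m1 m2 n1 n2 (N : rep k n1 n2) (M : rep k m1 m2) : k :=
  coord_det (coords_homs k m1 m2 n1 n2) (coords_rep k m1 n2) (hom_diff N M).

Lemma euler_form_eq0 m1 m2 n1 n2 :
  euler_form (m1, m2) (n1, n2) = 0 <-> (m1 * n1 + m2 * n2 = 3 * (m1 * n2))%N.
Proof.
rewrite /euler_form /= -PoszD; split=> [/eqP|->]; last by rewrite subrr.
by rewrite subr_eq0 => /eqP [].
Qed.

(* Write [S X = Hom(M1, X1) (+) Hom(M2, X2)] and [T X = Hom(M1, X2)^3], so that
   Hom(M, X) is the kernel of [hom_diff X M : S X -> T X].  The determinant of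
   [Psi : S I0 -> T I0 (+) Hom(M, I1)] is computed in two ways: composed with the
   inverse of [theta : S I0 -> T I0 (+) Hom(M, I0)] it becomes block triangular
   with diagonal blocks 1 and Hom(M, I0) -> Hom(M, I1), whereas splitting
   N -> I0 -> I1 exhibits [hom_diff N M] and [theta] for I1. *)
Lemma schofield_std_det m1 m2 n1 n2 (N : rep k n1 n2) (c : rep k m1 m2 -> k) :
  is_schofield N c -> exists kappa, forall M, c M = kappa * std_det N M.
Proof.
case=> /euler_form_eq0 euler [R [T0 [T1 [e cE]]]].
case: R T0 T1 e cE => p1 p2 q1 q2 I0 I1 iota pi _ _ /= iota_hom pi_hom
  [iota_mono1 iota_mono2] [iota_ker1 iota_ker2] [pi_epi1 pi_epi2]
  [x1 x2 t0 t0_bij] [y1 y2 t1 t1_bij]; rewrite /hom_dim /= => e cE.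
have [rho1 [s1 [irho1 spi1 ipi1 srho1 split1]]] := split_exact iota_mono1 iota_ker1 pi_epi1.
have [rho2 [s2 [irho2 spi2 ipi2 srho2 split2]]] := split_exact iota_mono2 iota_ker2 pi_epi2.
pose sec : pair_mx k q1 q2 p1 p2 := (s1, s2).
pose rho : pair_mx k p1 p2 n1 n2 := (rho1, rho2).
pose cSN := coords_homs k m1 m2 n1 n2.
pose cS0 := coords_homs k m1 m2 p1 p2.
pose cS1 := coords_homs k m1 m2 q1 q2.
pose cP1 := coords_homs k m1 m2 y1 y2.
pose cTN := coords_rep k m1 n2.
pose cT0 := coords_rep k m1 p2.
pose cT1 := coords_rep k m1 q2.
pose sigma (x : ('M[k]_(m1, n1) * 'M[k]_(m2, n2)) * ('M[k]_(m1, q1) * 'M[k]_(m2, q2))) :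
    'M[k]_(m1, p1) * 'M[k]_(m2, p2) :=
  (hom_comp x.1 iota : 'M_(_, _) * 'M_(_, _)) + hom_comp x.2 sec.
pose sigma' (x : 'M[k]_(m1, p1) * 'M[k]_(m2, p2)) :
  ('M[k]_(m1, n1) * 'M[k]_(m2, n2)) * ('M[k]_(m1, q1) * 'M[k]_(m2, q2)) :=
  (hom_comp x rho, hom_comp x pi).
pose beta (y : {ffun 'I_3 -> 'M[k]_(m1, p2)} * ('M[k]_(m1, y1) * 'M[k]_(m2, y2))) :=
  (rep_mulr rho.2 y.1, (rep_mulr pi.2 y.1, y.2)).
pose beta' (y : {ffun 'I_3 -> 'M[k]_(m1, n2)} *
      ({ffun 'I_3 -> 'M[k]_(m1, q2)} * ('M[k]_(m1, y1) * 'M[k]_(m2, y2)))) :=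
  (rep_mulr iota.2 y.1 + rep_mulr sec.2 y.2.1, y.2.2).
have lsigma : linear sigma.
  by move=> a x y; rewrite /sigma /= !hom_comp_linear scalerDr addrACA.
have lsigma' : linear sigma' by apply: linear_pair; exact: hom_comp_linear.
have lbeta : linear beta by move=> a x y; rewrite /beta /= !rep_mulr_linear.
have lbeta' : linear beta'.
  by move=> a x y; congr (_, _); rewrite /= !rep_mulr_linear scalerDr addrACA.
have sigmaK : cancel sigma sigma'.
  case=> [[f1 f2] [g1 g2]]; rewrite /sigma /sigma' /hom_comp /= !mulmxDl -!mulmxA.
  by rewrite irho1 irho2 ipi1 ipi2 spi1 spi2 srho1 srho2 !mulmx0 !mulmx1 !addr0 !add0r.
have sigmaVK : cancel sigma' sigma.
  case=> f1 f2; rewrite /sigma /sigma' /hom_comp /= [LHS]surjective_pairing /= -!mulmxA -!mulmxDr.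
  by rewrite split1 split2 !mulmx1.
have betaK : cancel beta beta'.
  case=> tau P; rewrite /beta /beta' /=; congr (_, _); apply/ffunP => i.
  by rewrite !ffunE -!mulmxA -mulmxDr split2 mulmx1.
have betaVK : cancel beta' beta.
  case=> tau [tau' P]; rewrite /beta /beta' /=; congr (_, (_, _)); apply/ffunP => i;
    rewrite !ffunE mulmxDl -!mulmxA.
  - by rewrite irho2 srho2 mulmx0 mulmx1 addr0.
  - by rewrite ipi2 spi2 mulmx0 mulmx1 add0r.
have dim_sigma := coord_dim_eq (coords_pair cSN cS1) cS0 lsigma lsigma' sigmaK sigmaVK.
have dim_theta0 := theta_dim t0_bij m1 m2.
pose M0 : rep k m1 m2 := (0 : {ffun 'I_3 -> 'M_(m1, m2)}).
pose dsigma := coord_det (coords_pair cSN cS1) cS0 sigma.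
pose dbeta := coord_det (coords_pair cT0 cP1) (coords_pair cTN (coords_pair cT1 cP1)) beta.
pose dtheta0 := coord_det cS0 (coords_theta k p2 x1 x2 m1 m2) (theta I0 t0 M0).
pose dtheta1 := coord_det cS1 (coords_theta k q2 y1 y2 m1 m2) (theta I1 t1 M0).
have dsigma0 : dsigma != 0 by apply: (coord_det_neq0 _ _ lsigma lsigma').
have dbeta0 : dbeta != 0 by apply: (coord_det_neq0 _ _ lbeta lbeta').
have dtheta00 : dtheta0 != 0 := coord_det_theta_neq0 t0_bij M0.
(* Both [theta] determinants are evaluated at the zero representation [M0], so the constant is free
   of [M]; [coord_det_theta] allows this. *)
exists (dtheta1 / (dsigma * dtheta0 * dbeta)) => M.
pose Psi (x : 'M[k]_(m1, p1) * 'M[k]_(m2, p2)) :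
  {ffun 'I_3 -> 'M[k]_(m1, p2)} * ('M[k]_(m1, y1) * 'M[k]_(m2, y2)) :=
  (hom_diff I0 M x, hom_comp (hom_comp x pi) t1).
have lPsi : linear Psi.
  by apply: linear_pair; [exact: hom_diff_linear | move=> a x y; rewrite !hom_comp_linear].
have PsiE : coord_det cS0 (coords_pair cT0 cP1) Psi = dtheta0 * c M.
  have [g lg [gK gVK]] := theta_inverse t0_bij M.
  have [D [DE ->]] := cE M.
  pose Dmap (P : 'M[k]_(m1, x1) * 'M[k]_(m2, x2)) : 'M[k]_(m1, y1) * 'M[k]_(m2, y2) :=
     hom_comp (hom_comp (g (0, P)) pi) t1.
  have lDmap : linear Dmap.
    move=> a P P'; rewrite /Dmap -!hom_comp_linear -lg; congr (hom_comp (hom_comp (g (_, _)) _) _).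
    by rewrite /= scaler0 add0r.
  have gE y : hom_diff I0 M (g y) = y.1 /\ hom_comp (g y) t0 = y.2 by rewrite -{2 4}(gVK y).
  rewrite (@eq_coord_det _ _ _ _ _ _ _ _ ((Psi \o g) \o theta I0 t0 M)); last first.
    by move=> x /=; rewrite gK.
  rewrite (@coord_det_comp _ _ _ _ _ _ _ _ (coords_theta k p2 x1 x2 m1 m2)) //;
    [|exact: theta_linear | exact: linear_comp].
  rewrite (coord_det_theta t0_bij); congr (_ * _).
  rewrite (@coord_det_upper _ _ _ _ _ _ _ _ _ _ _ _ _ id Dmap) ?coord_det_id ?mul1r //.
  - apply: coord_det_cast lDmap _ => P; have [/hom_diff_eq0 gP gP2] := gE (0, P).
    by rewrite -DE // /hom_coords gP2.
  - by move=> x; rewrite /Psi /= (gE _).1.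
  - by move=> y; rewrite /Psi /= (gE _).1.
(* After the splittings [sigma] and [beta], [Psi] factors as [Tri] followed by [Theta1]. [Tri] is
   triangular with diagonal blocks [hom_diff N M] and 1; [Theta1] is diagonal with blocks 1 and
   [theta] for [I1]. *)
pose Tri x := ((beta (Psi (sigma x))).1, x.2).
have lTri : linear Tri by move=> a x y; rewrite /Tri lsigma lPsi lbeta.
pose Theta1 (x : {ffun 'I_3 -> 'M[k]_(m1, n2)} * ('M[k]_(m1, q1) * 'M[k]_(m2, q2))) :=
  (x.1, theta I1 t1 M x.2).
have lTheta1 : linear Theta1 by move=> a x y; rewrite /Theta1 /= theta_linear.
have sigma_pi x : hom_comp (sigma x) pi = x.2.
  by have /(congr1 snd) := sigmaK x.
have betaPsi : (beta \o Psi) \o sigma =1 Theta1 \o Tri.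
  move=> x; congr (_, _); rewrite /= /theta -(sigma_pi x).
  by rewrite (hom_diff_compr _ _ pi_hom).
have TriE : coord_det (coords_pair cSN cS1) (coords_pair cTN cS1) Tri = std_det N M.
  rewrite (@coord_det_lower _ _ _ _ _ _ _ _ _ _ _ _ _ (hom_diff N M) id) ?coord_det_id ?mulr1 // => x.
  rewrite /Tri /=; congr (_, _).
  rewrite -[sigma _]/((hom_comp x iota : 'M_(_, _) * 'M_(_, _)) + _).
  have -> : hom_comp (0 : 'M[k]_(m1, q1) * 'M[k]_(m2, q2)) sec = 0 by rewrite /hom_comp !mul0mx.
  rewrite addr0 (hom_diff_compr _ _ iota_hom); apply/ffunP => i.
  by rewrite !ffunE -mulmxA irho2 mulmx1.
have Theta1E :
  coord_det (coords_pair cTN cS1) (coords_pair cTN (coords_pair cT1 cP1)) Theta1 = dtheta1.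
  rewrite (@coord_det_lower _ _ _ _ _ _ _ _ _ cTN cS1 cTN (coords_pair cT1 cP1)
    id (theta I1 t1 M) (erefl _) (theta_dim t1_bij m1 m2)) ?coord_det_id ?mul1r //.
  - exact: coord_det_theta.
  - by move=> x; rewrite /Theta1 /= theta0.
have: dsigma * (dtheta0 * c M) * dbeta = std_det N M * dtheta1.
  rewrite -TriE -Theta1E -coord_det_comp //; last by rewrite euler.
  rewrite -(eq_coord_det _ _ betaPsi) -PsiE.
  rewrite (@coord_det_comp _ _ _ _ _ _ _ _ cS0) //; last exact: linear_comp.
  rewrite (@coord_det_comp _ _ _ _ _ _ _ _ (coords_pair cT0 cP1)) ?mulrA //.
  by rewrite dim_theta0 e.
move=> detE; have D0 : dsigma * dtheta0 * dbeta != 0 by rewrite !mulf_neq0.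
apply: (mulfI D0); rewrite mulrA [_ * (dtheta1 / _)]mulrC divfK // [RHS]mulrC -detE.
by rewrite mulrA mulrAC.
Qed.

End SchofieldDeterminant.

(** * Regular functions and semi-invariance *)

Section RegularFunctions.
Variables (k : fieldType) (X : Type).

(** Abstracted so that polynomial functions and fractions with powers of [delta] as denominators
    share the closure lemmas; stability under pointwise equality replaces functional
    extensionality. *)
Definition function_ring (A : (X -> k) -> Prop) : Prop :=
  [/\ forall f g, f =1 g -> A f -> A g,
      forall c, A (fun _ => c),
      forall f g, A f -> A g -> A (fun x => f x + g x)
    & forall f g, A f -> A g -> A (fun x => f x * g x)].

Section Closure.
Variable A : (X -> k) -> Prop.
Hypothesis ringA : function_ring A.

Lemma function_ring_sum I (r : seq I) (P : pred I) (F : I -> X -> k) :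
  (forall i, A (F i)) -> A (fun x => \sum_(i <- r | P i) F i x).
Proof.
have [extA cstA addA _] := ringA => AF; elim: r => [|i r IH].
  by apply: extA (cstA 0) => x; rewrite big_nil.
have /extA : (if P i then (fun x => F i x + \sum_(j <- r | P j) F j x) else
                 (fun x => \sum_(j <- r | P j) F j x)) =1
             (fun x => \sum_(j <- i :: r | P j) F j x).
  by move=> x; rewrite big_cons; case: (P i).
by apply; case: (P i) => //; exact: addA.
Qed.

Lemma function_ring_prod I (r : seq I) (P : pred I) (F : I -> X -> k) :
  (forall i, A (F i)) -> A (fun x => \prod_(i <- r | P i) F i x).
Proof.
have [extA cstA _ mulA] := ringA => AF; elim: r => [|i r IH].
  by apply: extA (cstA 1) => x; rewrite big_nil.
have /extA : (if P i then (fun x => F i x * \prod_(j <- r | P j) F j x) else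
                 (fun x => \prod_(j <- r | P j) F j x)) =1
             (fun x => \prod_(j <- i :: r | P j) F j x).
  by move=> x; rewrite big_cons; case: (P i).
by apply; case: (P i) => //; exact: mulA.
Qed.

Lemma function_ring_mulmx m n p (F : X -> 'M[k]_(m, n)) (G : X -> 'M[k]_(n, p)) :
  (forall i j, A (fun x => F x i j)) -> (forall i j, A (fun x => G x i j)) ->
  forall i j, A (fun x => (F x *m G x) i j).
Proof.
have [extA _ _ mulA] := ringA => AF AG i j.
apply: (extA (fun x => \sum_l F x i l * G x l j)) => [x|]; first by rewrite mxE.
by apply: function_ring_sum => l; exact: mulA.
Qed.

Lemma function_ring_det n (F : X -> 'M[k]_n) :
  (forall i j, A (fun x => F x i j)) -> A (fun x => \det (F x)).
Proof.
have [_ cstA _ mulA] := ringA => AF; apply: function_ring_sum => s.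
apply: (mulA (fun=> _)); first exact: cstA.
by apply: function_ring_prod => i.
Qed.

Lemma function_ring_meval n (p : {mpoly k[n]}) (F : X -> 'I_n -> k) :
  (forall i, A (F^~ i)) -> A (fun x => p.@[F x]).
Proof.
have [extA cstA _ mulA] := ringA => AF.
apply: (extA (fun x => \sum_(m <- msupp p) p@_m * \prod_i \prod_(l < m i) F x i)).
  move=> x; rewrite mevalE; apply: eq_bigr => m _; congr (_ * _).
  by apply: eq_bigr => i _; rewrite prodr_const card_ord.
apply: function_ring_sum => m; apply: mulA; first exact: cstA.
by apply: function_ring_prod => i; apply: function_ring_prod.
Qed.

End Closure.

Variables (n : nat) (v : X -> 'rV[k]_n).

Definition polynomial_in (f : X -> k) : Prop :=
  exists p : {mpoly k[n]}, forall x, f x = p.@[fun i => v x 0 i].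

Lemma polynomial_in_ring : function_ring polynomial_in.
Proof.
split=> [f g fg [p fp]|c|f g [p fp] [q gq]|f g [p fp] [q gq]].
- by exists p => x; rewrite -fg.
- by exists c%:MP => x; rewrite mevalC.
- by exists (p + q) => x; rewrite mevalD fp gq.
- by exists (p * q) => x; rewrite mevalM fp gq.
Qed.

Lemma polynomial_in_coord i : polynomial_in (fun x => v x 0 i).
Proof. by exists 'X_i => x; rewrite mevalXU. Qed.

Variables (D : pred X) (delta : X -> k).

Definition fraction_in (f : X -> k) : Prop :=
  exists (p : {mpoly k[n]}) (e : nat),
    forall x, D x -> f x = p.@[fun i => v x 0 i] / delta x ^+ e.

Lemma eq_fraction_in f g : {in D, f =1 g} -> fraction_in f -> fraction_in g.
Proof. by move=> fg [p [e fp]]; exists p, e => x Dx; rewrite -fg // fp. Qed.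

Lemma polynomial_in_fraction f : polynomial_in f -> fraction_in f.
Proof. by move=> [p fp]; exists p, 0%N => x _; rewrite divr1. Qed.

Hypotheses (delta_poly : polynomial_in delta) (delta_neq0 : forall x, D x -> delta x != 0).

Lemma fraction_in_ring : function_ring fraction_in.
Proof.
split=> [f g fg|c|f g [p [e fp]] [q [e' gq]]|f g [p [e fp]] [q [e' gq]]].
- by apply: eq_fraction_in => x _.
- by apply: polynomial_in_fraction; have [_ + _ _] := polynomial_in_ring; apply.
- have [d dE] := delta_poly; exists (p * d ^+ e' + q * d ^+ e), (e + e')%N => x Dx.
  rewrite mevalD !mevalM !rmorphXn /= -dE fp // gq // exprD.
  by field; rewrite !expf_neq0 ?delta_neq0.
- exists (p * q), (e + e')%N => x Dx; rewrite mevalM fp // gq // exprD.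
  by field; rewrite !expf_neq0 ?delta_neq0.
Qed.

Lemma fraction_in_inv : fraction_in (fun x => (delta x)^-1).
Proof. by exists 1, 1%N => x _; rewrite meval1 expr1 mul1r. Qed.

End RegularFunctions.

(** * The group action and its characters *)

Section SemiInvariants.
Variable k : fieldType.
Hypothesis char0 : [pchar k] =i pred0.

Lemma two_neq0 : 2%:R != 0 :> k.
Proof. by move/pcharf0P: char0 => ->. Qed.

Lemma sum_ord2 (V : nmodType) (F : 'I_2 -> V) : \sum_i F i = F 0 + F 1.
Proof.
by rewrite !big_ord_recl big_ord0 addr0; congr (F _ + F _); apply/val_inj.
Qed.

Definition sym_coef (h : 'M[k]_2) : 'M[k]_3 :=
  \matrix_(i, j) arrow_coord (sym_act h (arrow k i)) j.

(** The symmetric square of [h] in the basis of arrows; the factors 2 in the middle row come from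
    a_2 = 2 w1 w2. *)
Lemma sym_coefE h : sym_coef h = \matrix_(i, j)
  (nth [::] [:: [:: h 0 0 ^+ 2; h 0 0 * h 1 0; h 1 0 ^+ 2];
             [:: 2%:R * (h 0 0 * h 0 1); h 0 0 * h 1 1 + h 0 1 * h 1 0; 2%:R * (h 1 0 * h 1 1)];
             [:: h 0 1 ^+ 2; h 0 1 * h 1 1; h 1 1 ^+ 2]] i)`_j.
Proof.
apply/matrixP => i j; rewrite !mxE /sym_act /arrow_coord /arrow /sym_mul /w1 /w2.
rewrite !trmx_delta !mul_delta_mx.
by case: i => [[|[|[|//]]] ?]; case: j => [[|[|[|//]]] ?] /=;
  rewrite !mxE !sum_ord2 !mxE !sum_ord2 !mxE /=;
  field; exact: two_neq0.
Qed.

Lemma sym_coef1 : sym_coef 1%:M = 1%:M.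
Proof.
apply/matrixP => i j; rewrite sym_coefE !mxE.
by case: i => [[|[|[|//]]] ?]; case: j => [[|[|[|//]]] ?] /=; ring.
Qed.

(** The order reverses because row [i] holds the coordinates of the image of arrow [i]. Together
    with the inverse in [rep_act] this gives a left action. *)
Lemma sym_coefM h h' : sym_coef (h *m h') = sym_coef h' *m sym_coef h.
Proof.
apply/matrixP => i j; rewrite !sym_coefE !mxE !sum_ord2 !big_ord_recl big_ord0 !mxE.
by case: i => [[|[|[|//]]] ?]; case: j => [[|[|[|//]]] ?] /=; ring.
Qed.

(** Linear substitution of the arrows: it reduces the GL(W)-action to products of 3 x 3 matrices and
    commutes with base change. *)
Definition twist m1 m2 (R : 'M[k]_3) (M : rep k m1 m2) : rep k m1 m2 :=
  [ffun i => \sum_j R i j *: M j].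

Lemma twistM m1 m2 R S (M : rep k m1 m2) : twist R (twist S M) = twist (R *m S) M.
Proof.
apply/ffunP => i; rewrite !ffunE; under eq_bigr do rewrite ffunE scaler_sumr.
rewrite exchange_big; apply: eq_bigr => l _; rewrite mxE scaler_suml.
by apply: eq_bigr => j _; rewrite scalerA.
Qed.

Lemma twist1 m1 m2 (M : rep k m1 m2) : twist 1%:M M = M.
Proof.
apply/ffunP => i; rewrite ffunE (bigD1 i) //= mxE eqxx scale1r big1 ?addr0 // => j ji.
by rewrite mxE eq_sym (negPf ji) scale0r.
Qed.

Lemma mul_twist m1 m2 n1 n2 R (M : rep k m1 m2) (A : 'M_(n1, m1)) (B : 'M_(m2, n2)) i :
  A *m twist R M i *m B = twist R [ffun j => A *m M j *m B] i.
Proof.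
rewrite !ffunE mulmx_sumr mulmx_suml; apply: eq_bigr => j _.
by rewrite ffunE -scalemxAr -scalemxAl.
Qed.

Lemma rep_actE m1 m2 (g : triple_mx k m1 m2) (M : rep k m1 m2) i :
  rep_act g M i = g.1.1 *m twist (sym_coef (invmx g.2)) M i *m invmx g.1.2.
Proof.
rewrite !ffunE /rep_ext; congr (_ *m _ *m _); apply: eq_bigr => j _.
by rewrite mxE.
Qed.

Lemma invmxM n (A B : 'M[k]_n) : A \in unitmx -> B \in unitmx ->
  invmx (A *m B) = invmx B *m invmx A.
Proof.
move=> uA uB; have uAB : A *m B \in unitmx by rewrite unitmx_mul uA.
by rewrite -[RHS](mulKmx uAB) -mulmxA (mulmxA B) mulmxV // mul1mx mulmxV // mulmx1.
Qed.

Section Action.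
Variables m1 m2 : nat.
Implicit Types (g : triple_mx k m1 m2) (M : rep k m1 m2).

Lemma in_GL_inv g : in_GL g -> in_GL (GL_inv g).
Proof. by rewrite /in_GL /= !unitmx_inv. Qed.

Lemma rep_act_mul g g' M : in_GL g -> in_GL g' ->
  rep_act (GL_mul g g') M = rep_act g (rep_act g' M).
Proof.
case/and3P=> _ u2 u3 /and3P[_ u2' u3'].
apply/ffunP => i; rewrite !rep_actE /= !invmxM // sym_coefM -twistM.
rewrite [LHS]mulmxA -(mulmxA g.1.1) -(mulmxA g.1.1) mul_twist.
by congr (_ *m twist _ _ i *m _); apply/ffunP => j; rewrite ffunE rep_actE.
Qed.

Lemma rep_act_inv g M : in_GL g -> rep_act g (rep_act (GL_inv g) M) = M.
Proof.
move=> ug; rewrite -rep_act_mul ?in_GL_inv //.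
case/and3P: ug => u1 u2 u3; apply/ffunP => i; rewrite rep_actE /= !mulmxV //.
by rewrite invmx1 invmx1 sym_coef1 twist1 mul1mx mulmx1.
Qed.

Lemma GL_inv_mul g g' : in_GL g -> in_GL g' ->
  GL_inv (GL_mul g g') = GL_mul (GL_inv g') (GL_inv g).
Proof. by case/and3P=> ? ? ? /and3P[? ? ?]; rewrite /GL_inv /= !invmxM. Qed.

Lemma GL_invK g : GL_inv (GL_inv g) = g.
Proof. by case: g => [[? ?] ?]; rewrite /GL_inv /= !invmxK. Qed.

Let delta g := \det g.1.1 * \det g.1.2 * \det g.2.
Let poly := polynomial_in (@GL_coords k m1 m2).
Let frac := fraction_in (@GL_coords k m1 m2) (@in_GL k m1 m2) delta.

Let poly1 i j : poly (fun g => g.1.1 i j).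
Proof.
have [+ _ _ _] := polynomial_in_ring (@GL_coords k m1 m2).
apply; last exact: (polynomial_in_coord _ (lshift _ (lshift _ (mxvec_index i j)))).
by move=> g; rewrite /GL_coords !row_mxEl mxvecE.
Qed.

Let poly2 i j : poly (fun g => g.1.2 i j).
Proof.
have [+ _ _ _] := polynomial_in_ring (@GL_coords k m1 m2).
apply; last exact: (polynomial_in_coord _ (lshift _ (rshift _ (mxvec_index i j)))).
by move=> g; rewrite /GL_coords row_mxEl row_mxEr mxvecE.
Qed.

Let poly3 i j : poly (fun g => g.2 i j).
Proof.
have [+ _ _ _] := polynomial_in_ring (@GL_coords k m1 m2).
apply; last exact: (polynomial_in_coord _ (rshift _ (mxvec_index i j))).
by move=> g; rewrite /GL_coords row_mxEr mxvecE.
Qed.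

Let poly_det1 : poly (fun g => \det g.1.1).
Proof. by apply: function_ring_det => //; exact: polynomial_in_ring. Qed.
Let poly_det2 : poly (fun g => \det g.1.2).
Proof. by apply: function_ring_det => //; exact: polynomial_in_ring. Qed.
Let poly_det3 : poly (fun g => \det g.2).
Proof. by apply: function_ring_det => //; exact: polynomial_in_ring. Qed.

Let poly_delta : poly delta.
Proof.
have [_ _ _ mulP] := polynomial_in_ring (@GL_coords k m1 m2).
exact: (mulP _ _ (mulP _ _ poly_det1 poly_det2) poly_det3).
Qed.

Let delta_neq0 g : in_GL g -> delta g != 0.
Proof. by case/and3P; rewrite !unitmxE !unitfE => u1 u2 u3; rewrite !mulf_neq0. Qed.

Let fracP : function_ring frac := fraction_in_ring poly_delta delta_neq0.

Let frac_inv1 i j : frac (fun g => invmx g.1.1 i j).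
Proof.
have [_ cstF _ mulF] := fracP.
have [extP cstP _ mulP] := polynomial_in_ring (@GL_coords k m1 m2).
(* Cramer's rule, with the denominator [\det g.1.1] completed to [delta], the only denominator
   available in [frac]. *)
apply: (@eq_fraction_in _ _ _ _ _ _
  (fun g => (delta g)^-1 * ((\det g.1.2 * \det g.2) * \adj g.1.1 i j))).
  move=> g ug; case/and3P: (ug) (delta_neq0 ug) => u1 u2 u3.
  rewrite /invmx u1 !mxE /delta !mulf_eq0 !negb_or -andbA => /and3P[n1 n2 n3].
  by field; rewrite n1 n2 n3.
apply: mulF; first exact: fraction_in_inv.
apply: polynomial_in_fraction; apply: (mulP _ _ (mulP _ _ poly_det2 poly_det3)).
apply: (extP (fun g => (-1) ^+ (j + i) * \det (row' j (col' i g.1.1)))).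
  by move=> g; rewrite !mxE.
apply: mulP; first exact: cstP.
apply: function_ring_det => [|a b]; first exact: polynomial_in_ring.
by apply: extP (poly1 (lift j a) (lift i b)) => g; rewrite !mxE.
Qed.

Let poly_sym_coef i j : poly (fun g => sym_coef g.2 i j).
Proof.
have ringP := polynomial_in_ring (@GL_coords k m1 m2); have [extP cstP _ _] := ringP.
have entry a b : poly (fun g => sym_act g.2 (arrow k i) a b).
  apply: function_ring_mulmx => // {a b} a b; last by apply: extP (poly3 b a) => g; rewrite mxE.
  by apply: function_ring_mulmx => // {a b} a b; exact: cstP.
case: j => [[|[|[|//]]] ltj];
  by [apply: extP (entry 0 0) => g; rewrite [RHS]mxE |
      apply: extP (entry 0 1) => g; rewrite [RHS]mxE |
      apply: extP (entry 1 1) => g; rewrite [RHS]mxE].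
Qed.

(** Acting by the inverse of [g] cancels the inverses of [g.1.2] and [g.2], leaving [invmx g.1.1] as
    the only factor that is not polynomial. *)
Let frac_rep_act M i a b : frac (fun g => rep_act (GL_inv g) M i a b).
Proof.
have [extF cstF _ mulF] := fracP.
apply: (@eq_fraction_in _ _ _ _ _ _
  (fun g => (invmx g.1.1 *m twist (sym_coef g.2) M i *m g.1.2) a b)).
  by move=> g _; rewrite rep_actE /= !invmxK.
apply: function_ring_mulmx => // {a b} a b; last exact/polynomial_in_fraction/poly2.
apply: function_ring_mulmx => // {a b} a b.
apply: (extF (fun g => \sum_j sym_coef g.2 i j * M j a b)).
  by move=> g; rewrite ffunE summxE; apply: eq_bigr => j _; rewrite [RHS]mxE.
apply: function_ring_sum => // j; apply: mulF (cstF _).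
exact/polynomial_in_fraction/poly_sym_coef.
Qed.

Lemma rep_coordsE M i a b : rep_coords M 0 (mxvec_index i (mxvec_index a b)) = M i a b.
Proof. by rewrite /rep_coords mxvecE mxE mxvecE. Qed.

(* Unless [f = 0], the character is [g |-> f (g^-1 M0) / f M0] for any [M0] with
   [f M0 != 0]. *)
Lemma semi_invariant_of_scalar (f : rep k m1 m2 -> k) :
  regular_on_rep f ->
  (forall g, in_GL g -> exists lambda, forall M, fun_act g f M = lambda * f M) ->
  semi_invariant f.
Proof.
move=> f_reg f_scal; split=> //.
(* Excluded middle decides whether [f] vanishes identically; if so, the trivial character serves. *)
have [[M0 fM0]|f0] := classic (exists M0, f M0 <> 0); last first.
  have {}f0 M : f M = 0 by apply: NNPP => fM; apply: f0; exists M.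
  exists (fun _ => 1); split; last by move=> g _ M; rewrite /fun_act !f0 mulr0.
  split=> [g _|g g' _ _|]; rewrite ?oner_neq0 ?mulr1 //.
  by exists 1, 0%N => g _; rewrite meval1 expr0 divr1.
move/eqP: fM0 => fM0; pose chi g := f (rep_act (GL_inv g) M0) / f M0.
have chiE g M : in_GL g -> fun_act g f M = chi g * f M.
  move=> /f_scal[lambda fE]; rewrite fE /chi; congr (_ * _).
  by rewrite -/(fun_act g f M0) fE mulfK.
exists chi; split; last by move=> g ug M; exact: chiE.
split=> [g ug|g g' ug ug'|].
- have := chiE (GL_inv g) (rep_act (GL_inv g) M0) (in_GL_inv ug).
  rewrite /fun_act GL_invK rep_act_inv // => fM0E.
  rewrite mulf_neq0 ?invr_neq0 //; apply: contraNneq (fM0) => fg0.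
  by rewrite fM0E fg0 mulr0.
- rewrite {1}/chi GL_inv_mul // rep_act_mul ?in_GL_inv //.
  rewrite -[f (rep_act (GL_inv g') _)]/(fun_act g' f _) (chiE g') // -[f _]/(fun_act g f _) (chiE g) //.
  by rewrite [chi g * f M0]mulrC mulrCA mulrAC divff // mul1r mulrC.
have [p fp] := f_reg; suff [q [e chiq]] : frac chi by exists q, e.
have [extF cstF _ mulF] := fracP; apply: mulF (cstF _).
apply: (extF (fun g => p.@[fun i => rep_coords (rep_act (GL_inv g) M0) 0 i])).
  by move=> g; rewrite fp.
apply: function_ring_meval => // r; case/mxvec_indexP: r => i r; case/mxvec_indexP: r => a b.
by apply: (extF _ _ _ (frac_rep_act M0 i a b)) => g; rewrite rep_coordsE.
Qed.

End Action.

(** * Semi-invariance of the standard determinant *)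

Lemma std_det_regular m1 m2 n1 n2 (N : rep k n1 n2) :
  regular_on_rep (std_det N : rep k m1 m2 -> k).
Proof.
have ringP := polynomial_in_ring (@rep_coords k m1 m2); have [extP cstP addP mulP] := ringP.
have coordP i a b : polynomial_in (@rep_coords k m1 m2) (fun M => M i a b).
  apply: extP (polynomial_in_coord _ (mxvec_index i (mxvec_index a b))) => M.
  exact: rep_coordsE.
apply: (function_ring_det ringP) => r s.
apply: (function_ring_mulmx ringP) => {r s} r s; last exact: cstP.
case/mxvec_indexP: s => i s; case/mxvec_indexP: s => a b.
pose x := dec (coords_homs k m1 m2 n1 n2) (delta_mx 0 r).
apply: (extP (fun M => (M i *m x.2) a b + - (x.1 *m N i) a b)).
  by move=> M; rewrite [RHS]mxE /= rep_coordsE ffunE !mxE.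
apply: addP (cstP _); apply: (function_ring_mulmx ringP) => // *; exact: cstP.
Qed.

(** The twist of [N] by [h] is undone by a base change. [Q] is kept on the left side and inverted
    later, which lets [P] and [Q] be chosen polynomial in [h]. *)
Definition sym_equivariant n1 n2 (N : rep k n1 n2) : Prop :=
  forall h, h \in unitmx -> exists P Q, Q \in unitmx /\
    forall i, twist (sym_coef h) N i *m Q = P *m N i.

(** [hom_diff N] at the translated representation equals [T \o hom_diff N M \o S] with [S] and [T]
    depending on [g] only, so [lambda] is the product of their determinants. *)
Lemma std_det_scalar m1 m2 n1 n2 (N : rep k n1 n2) (g : triple_mx k m1 m2) :
  sym_equivariant N -> (m1 * n1 + m2 * n2 = 3 * (m1 * n2))%N -> in_GL g ->
  exists lambda, forall M, std_det N (rep_act (GL_inv g) M) = lambda * std_det N M.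
Proof.
move=> N_sym euler /and3P[u1 u2 u3].
have [|P [Q [uQ PQ]]] := N_sym (invmx g.2); first by rewrite unitmx_inv.
pose cS := coords_homs k m1 m2 n1 n2; pose cT := coords_rep k m1 n2.
pose S (x : 'M[k]_(m1, n1) * 'M[k]_(m2, n2)) := (g.1.1 *m x.1 *m P, g.1.2 *m x.2 *m Q).
pose T (tau : {ffun 'I_3 -> 'M[k]_(m1, n2)}) : {ffun 'I_3 -> 'M[k]_(m1, n2)} :=
  [ffun i => invmx g.1.1 *m twist (sym_coef g.2) tau i *m invmx Q].
have lS : linear S.
  move=> a x y; congr (_, _); rewrite /= mulmxDr mulmxDl -scalemxAr -scalemxAl //.
have lT : linear T.
  move=> a x y; apply/ffunP => i; rewrite !ffunE.
  rewrite scalemxAl scalemxAr -mulmxDl -mulmxDr; congr (_ *m _ *m _).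
  rewrite scaler_sumr -big_split; apply: eq_bigr => j _.
  by rewrite !ffunE scalerDr !scalerA mulrC.
exists (coord_det cS cS S * coord_det cT cT T) => M.
have lN := hom_diff_linear N M.
rewrite mulrAC /std_det -(coord_det_comp _ _ _ lS lN) //.
rewrite -(coord_det_comp _ _ _ _ lT) //; last exact: linear_comp.
apply: eq_coord_det => x; apply/ffunP => i; rewrite [LHS]ffunE [RHS]ffunE.
(* Writing [N] as a twist by the same matrix that acts on [M] lets the twist be factored out of both
   terms of [hom_diff]. *)
have NE : N i = twist (sym_coef g.2) [ffun j => P *m N j *m invmx Q] i.
  rewrite (_ : [ffun j => _] = twist (sym_coef (invmx g.2)) N).
    by rewrite twistM -sym_coefM mulVmx // sym_coef1 twist1.
  by apply/ffunP => j; rewrite ffunE -PQ mulmxK.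
rewrite rep_actE /= !invmxK {1}NE -[x.1 *m _]mulmx1 -[_ *m x.2]mulmxA !mul_twist !ffunE -sumrB.
apply: eq_bigr => j _; rewrite -scalerBr !ffunE /=; congr (_ *: _).
rewrite mulmxBr mulmxBl mulmx1 -!mulmxA mulmxV // mulmx1 !mulmxA mulVmx // mul1mx.
by rewrite -!mulmxA.
Qed.

End SemiInvariants.

(** * Standard resolutions and the representations N1, N2 *)

Section StandardResolution.
Variable k : fieldType.

(** Through the trivialization, extending a homomorphism along a monomorphism becomes extending
    linear maps at each vertex, which [pinvmx] does; uniqueness of lifts shows that the extension
    restricts correctly. *)
Lemma triv_injective d1 d2 x1 x2 (I : rep k d1 d2) (t : pair_mx k d1 d2 x1 x2) :
  (forall m1 m2 (M : rep k m1 m2) (P : pair_mx k m1 m2 x1 x2),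
     exists! phi : pair_mx k m1 m2 d1 d2, is_hom M I phi /\ hom_comp phi t = P) ->
  injective_rep I.
Proof.
move=> t_bij m1 m2 n1 n2 M N j phi j_hom [j1 j2] phi_hom.
have [psi [[psi_hom psiE] _]] :=
  t_bij _ _ N (pinvmx j.1 *m (hom_comp phi t).1, pinvmx j.2 *m (hom_comp phi t).2).
exists psi; split => //.
have [chi [_ chi_uniq]] := t_bij _ _ M (hom_comp phi t).
rewrite -[RHS](chi_uniq phi) //; apply/esym/chi_uniq; split.
  by move=> i /=; rewrite mulmxA j_hom -!mulmxA psi_hom.
case: psiE => E1 E2; rewrite /hom_comp /= -!mulmxA E1 E2.
by rewrite (mulmxA j.1) (mulmxA j.2) !mulmxVp // !mul1mx.
Qed.

Section Resolution.
Variables (n1 n2 : nat) (N : rep k n1 n2).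

(** The canonical resolution. The indecomposable injectives have dimensions (1, 0) and (3, 1):
    [std_I0] consists of [n1] copies of the first and [n2] of the second, and the cokernel [std_I1]
    of [3 * n2] copies of the first. *)
Definition std_I0 : rep k (n1 + 3 * n2) n2 := [ffun i => col_mx 0 (arrow_proj k n2 i)].
Definition std_I1 : rep k (3 * n2) 0 := [ffun i => 0].
Definition std_t0 : pair_mx k (n1 + 3 * n2) n2 n1 n2 := (col_mx 1%:M 0, 1%:M).
Definition std_t1 : pair_mx k (3 * n2) 0 (3 * n2) 0 := (1%:M, 1%:M).
Definition std_iota : pair_mx k n1 n2 (n1 + 3 * n2) n2 := (row_mx 1%:M (rep_flat N), 1%:M).
Definition std_pi : pair_mx k (n1 + 3 * n2) n2 (3 * n2) 0 := (col_mx (- rep_flat N) 1%:M, 0).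

Definition std_hom m1 m2 (M : rep k m1 m2) (P : 'M[k]_(m1, n1) * 'M[k]_(m2, n2)) :
    'M[k]_(m1, n1 + 3 * n2) * 'M[k]_(m2, n2) :=
  (row_mx P.1 (rep_flat [ffun i => M i *m P.2]), P.2).

Lemma std_hom_uniq m1 m2 (M : rep k m1 m2) phi :
  is_hom M std_I0 phi -> std_hom M (hom_comp phi std_t0) = phi.
Proof.
case: phi => f1 f2; rewrite -[f1]hsubmxK => f_hom.
rewrite /std_hom /hom_comp /= mulmx1 mul_row_col mulmx1 mulmx0 addr0.
congr (row_mx _ _, _); apply: arrow_proj_inj => i.
by rewrite rep_flatK ffunE f_hom ffunE mul_row_col mulmx0 add0r.
Qed.

Lemma std_hom_hom m1 m2 (M : rep k m1 m2) P : is_hom M std_I0 (std_hom M P).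
Proof. by move=> i; rewrite ffunE /= mul_row_col mulmx0 add0r rep_flatK ffunE. Qed.

Lemma std_t0_bij m1 m2 (M : rep k m1 m2) (P : pair_mx k m1 m2 n1 n2) :
  exists! phi, is_hom M std_I0 phi /\ hom_comp phi std_t0 = P.
Proof.
exists (std_hom M P); split=> [|phi [phi_hom <-]]; last exact: std_hom_uniq.
split; first exact: std_hom_hom.
by case: P => P1 P2; rewrite /hom_comp /= mul_row_col !mulmx1 mulmx0 addr0.
Qed.

Lemma std_t1_bij m1 m2 (M : rep k m1 m2) (P : pair_mx k m1 m2 (3 * n2) 0) :
  exists! phi, is_hom M std_I1 phi /\ hom_comp phi std_t1 = P.
Proof.
case: P => P1 P2; exists (P1, P2); split=> [|[f1 f2] [_ <-]].
  by split=> [i|]; [rewrite [LHS]thinmx0 [RHS]thinmx0 | rewrite /hom_comp /= !mulmx1].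
by rewrite /hom_comp /= !mulmx1.
Qed.

Definition std_T0 : hom_trivialization std_I0 := HomTrivialization std_t0_bij.
Definition std_T1 : hom_trivialization std_I1 := HomTrivialization std_t1_bij.


Fact std_iota_hom : is_hom N std_I0 std_iota.
Proof. by move=> i; rewrite ffunE /= mul_row_col mulmx0 add0r rep_flatK mulmx1. Qed.

Fact std_pi_hom : is_hom std_I0 std_I1 std_pi.
Proof. by move=> i; rewrite [LHS]thinmx0 [RHS]thinmx0. Qed.

Fact std_mono : hom_mono std_iota.
Proof.
split; last by rewrite row_free_unit unitmx1.
by apply/row_freeP; exists (col_mx 1%:M 0); rewrite mul_row_col mulmx1 mulmx0 addr0.
Qed.

Fact std_exact : hom_exact std_iota std_pi.
Proof.
split; last by rewrite /= !kermx0 !submx_refl.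
rewrite /=; apply/andP; split.
  by apply/sub_kermxP; rewrite mul_row_col mul1mx mulmx1 addNr.
apply/row_subP => i; move: (row i _) (row_sub i (kermx std_pi.1)) => v /sub_kermxP.
rewrite -[v]hsubmxK mul_row_col mulmx1 mulmxN addrC => /eqP; rewrite subr_eq0 => /eqP->.
by apply/submxP; exists (lsubmx v); rewrite mul_mx_row mulmx1.
Qed.

Fact std_epi : hom_epi std_pi.
Proof.
split; last by rewrite /row_full -leqn0 rank_leq_col.
by apply/row_fullP; exists (row_mx 0 1%:M); rewrite mul_row_col mul0mx mul1mx add0r.
Qed.

Definition std_resolution : injective_resolution N :=
  InjectiveResolution (triv_injective std_t0_bij) (triv_injective std_t1_bij)
    std_iota_hom std_pi_hom std_mono std_exact std_epi.

Lemma schofield_exists m1 m2 : (m1 * n1 + m2 * n2 = 3 * (m1 * n2))%N ->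
  exists c : rep k m1 m2 -> k, is_schofield N c.
Proof.
move=> euler.
have e : hom_dim std_T1 m1 m2 = hom_dim std_T0 m1 m2.
  by rewrite /hom_dim /= muln0 addn0 euler mulnCA.
pose f M P : 'M[k]_(m1, 3 * n2) * 'M[k]_(m2, 0) :=
  hom_comp (hom_comp (std_hom M P) std_pi) std_t1.
pose D M : 'M[k]_(hom_dim std_T0 m1 m2) :=
  castmx (erefl, e) (coord_mx (coords_homs k m1 m2 n1 n2) (coords_homs k m1 m2 (3 * n2) 0) (f M)).
exists (fun M => \det (D M)); split; first exact/euler_form_eq0.
exists std_resolution, std_T0, std_T1, e => M; exists (D M); split => // phi phi_hom.
have lf : linear (f M).
  move=> a P P'; rewrite /f -!hom_comp_linear; congr (hom_comp (hom_comp _ _) _).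
  congr (_, _); rewrite /= scale_row_mx add_row_mx; congr (row_mx _ _).
  apply: arrow_proj_inj => i; rewrite mulmxDl -scalemxAl !rep_flatK !ffunE.
  by rewrite mulmxDr scalemxAr.
have mul_cast p q r (e' : q = r) (u : 'rV[k]_p) (A : 'M[k]_(p, q)) :
  u *m castmx (erefl, e') A = castmx (erefl, e') (u *m A) by subst r.
rewrite mul_cast; congr castmx; rewrite /hom_coords.
have := coord_mxE (coords_homs k m1 m2 n1 n2) (coords_homs k m1 m2 (3 * n2) 0) lf
  (hom_comp phi std_t0).
by rewrite /f std_hom_uniq // => ->.
Qed.

End Resolution.

Hypothesis char0 : [pchar k] =i pred0.

Lemma schofield_semi_invariant m1 m2 n1 n2 (N : rep k n1 n2) :
  sym_equivariant N -> (m1 * n1 + m2 * n2 = 3 * (m1 * n2))%N ->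
  (exists c : rep k m1 m2 -> k, is_schofield N c) /\
  (forall c : rep k m1 m2 -> k, is_schofield N c -> semi_invariant c).
Proof.
move=> N_sym euler; split=> [|c /schofield_std_det[kappa cE]]; first exact: schofield_exists.
apply: semi_invariant_of_scalar => // [|g ug].
  have [extP cstP _ mulP] := polynomial_in_ring (@rep_coords k m1 m2).
  apply: (extP (fun M => kappa * std_det N M)) => [M|]; first by rewrite cE.
  exact: mulP (cstP _) (std_det_regular _ _ N).
have [lambda lambdaE] := std_det_scalar char0 N_sym euler ug.
by exists lambda => M; rewrite /fun_act !cE lambdaE mulrCA.
Qed.

(** * Equivariance of [N1] and [N2] *)

Definition scalar_block b (h : 'M[k]_2) : 'M[k]_(b + b) :=
  block_mx (h 0 0)%:M (h 0 1)%:M (h 1 0)%:M (h 1 1)%:M.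

Lemma scalar_block_unit b (h : 'M[k]_2) : h \in unitmx -> scalar_block b h \in unitmx.
Proof.
move=> uh; suff /mulmx1_unit[] : scalar_block b h *m scalar_block b (invmx h) = 1%:M by [].
have hE i j : h i 0 * invmx h 0 j + h i 1 * invmx h 1 j = (i == j)%:R.
  by have /matrixP/(_ i j) := mulmxV uh; rewrite !mxE sum_ord2.
by rewrite mulmx_block -!scalar_mxM -!raddfD !hE /= raddf0 -scalar_mx_block.
Qed.

Lemma sum_ord3 (V : nmodType) (F : 'I_3 -> V) :
  \sum_i F i = F ord0 + F (lift ord0 ord0) + F (lift ord0 (lift ord0 ord0)).
Proof. by rewrite !big_ord_recl big_ord0 addr0 addrA. Qed.

(* [N1 x = S x J (x) B] for [x] in S^2(W), where [S = diag (-1, 1)] and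
   [J = [[0, 1], [-1, 0]]]; since [h^T J = J adj h], the action of [h] on [x]
   becomes multiplication by [S h S] and [adj h]. *)
Lemma N1_equivariant b (B : 'M[k]_b) : sym_equivariant (N1 B).
Proof.
move=> h uh; pose d := h 0 0 * h 1 1 - h 0 1 * h 1 0.
(* Multiplying by [h] on the right turns [adj h] into the scalar [d]: hence [Q] comes from [h] and
   [P] carries the factor [d]. *)
exists (d *: block_mx (h 0 0)%:M (- (h 0 1))%:M (- (h 1 0))%:M (h 1 1)%:M), (scalar_block b h).
split=> [|i]; first exact: scalar_block_unit.
rewrite !ffunE sum_ord3 !ffunE sym_coefE // !mxE /=.
case: i => [[|[|[|//]]] ?] /=;
  rewrite -scalemxAl !scale_block_mx !add_block_mx !mulmx_block ?mul_mx_scalar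
    ?mul_scalar_mx scale_block_mx;
  congr block_mx; apply/matrixP => r s; rewrite !mxE /d; ring.
Qed.

(* Up to a factor 2, [N2 x] is the action of [x] in S^2(W) as a second order
   constant coefficient operator S^3(W^* ) -> W^*, tensored with [B], in the basis
   [X^3, Y^3, X^2 Y, X Y^2]; [P] is the substitution of [h] on cubic forms. *)
Lemma N2_equivariant b (B : 'M[k]_b) : sym_equivariant (N2 B).
Proof.
move=> h uh.
(* Each row expands one basis cubic under X -> h 0 0 X + h 0 1 Y, Y -> h 1 0 X + h 1 1 Y, whence the
   binomial coefficients. [Q] is the same substitution on linear forms, and the identity to check is
   the chain rule. *)
pose P : 'M[k]_(b + b + (b + b)) := block_mx
  (block_mx (h 0 0 ^+ 3)%:M (h 0 1 ^+ 3)%:M (h 1 0 ^+ 3)%:M (h 1 1 ^+ 3)%:M)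
  (block_mx (3%:R * h 0 0 ^+ 2 * h 0 1)%:M (3%:R * h 0 0 * h 0 1 ^+ 2)%:M
            (3%:R * h 1 0 ^+ 2 * h 1 1)%:M (3%:R * h 1 0 * h 1 1 ^+ 2)%:M)
  (block_mx (h 0 0 ^+ 2 * h 1 0)%:M (h 0 1 ^+ 2 * h 1 1)%:M
            (h 0 0 * h 1 0 ^+ 2)%:M (h 0 1 * h 1 1 ^+ 2)%:M)
  (block_mx (h 0 0 ^+ 2 * h 1 1 + 2%:R * h 0 0 * h 0 1 * h 1 0)%:M
            (2%:R * h 0 0 * h 0 1 * h 1 1 + h 0 1 ^+ 2 * h 1 0)%:M
            (2%:R * h 0 0 * h 1 0 * h 1 1 + h 0 1 * h 1 0 ^+ 2)%:M
            (h 0 0 * h 1 1 ^+ 2 + 2%:R * h 0 1 * h 1 0 * h 1 1)%:M).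
exists P, (scalar_block b h); split=> [|i]; first exact: scalar_block_unit.
rewrite !ffunE sum_ord3 !ffunE sym_coefE // !mxE /= -(block_mx0 k b b b b).
case: i => [[|[|[|//]]] ?] /=;
  rewrite !(@scale_col_mx _ (b + b) (b + b)) !scale_block_mx !(@add_col_mx _ (b + b) (b + b))
    !add_block_mx (@mul_col_mx _ (b + b) (b + b)) !mulmx_block
    mul_block_col !mulmx_block !add_block_mx ?mul_mx_scalar ?mul_scalar_mx;
  congr (col_mx (block_mx _ _ _ _) (block_mx _ _ _ _)); apply/matrixP => r s; rewrite !mxE; ring.
Qed.

End StandardResolution.

Theorem proposition4p5 (k : fieldType) (hk : [pchar k] =i pred0)
    (b : nat) (hb : (1 <= b)%N) :
  for_general_pair (fun B1 B2 : 'M[k]_b =>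
    forall a : nat, (1 <= a)%N ->
      ((exists c : rep k a (2 * a) -> k, is_schofield (N1 B1) c) /\
       (forall c : rep k a (2 * a) -> k,
          is_schofield (N1 B1) c -> semi_invariant c)) /\
      ((exists c : rep k a a -> k, is_schofield (N2 B2) c) /\
       (forall c : rep k a a -> k,
          is_schofield (N2 B2) c -> semi_invariant c))).
Proof.
(* The open set is the whole space, the nonvanishing locus of the constant polynomial 1. *)
exists (fun _ => True); split=> [||v _ a _]; last split.
- exists (fun p => p = 1) => v; split=> // _.
  by exists 1; rewrite meval1 oner_neq0.
- by exists 0.
(* Vanishing of the Euler form: both sides equal 6ab, here and for [N2]. *)
- by apply: (schofield_semi_invariant hk (N1_equivariant hk _)); ring.
- by apply: (schofield_semi_invariant hk (N2_equivariant hk _)); ring.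
Qed.
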